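(* Let $R$ be an infinite commutative integral domain with identity, let $n\geqslant 2$ be an integer, and let $p\colon R^n\to R$ be one of the following functions: (i) $p(\mathbf{x})=c$, where $c\in R$; (ii) $p(\mathbf{x})=x_1$; (iii) $p(\mathbf{x})=x_n$; (iv) $p(\mathbf{x})=c+\sum_{i=1}^n x_i$, where $c\in R$; (v) (if $n\geqslant 3$) $p(\mathbf{x})=\sum_{i=1}^n \omega^{i-1}x_i$, where $\omega\in R\setminus\{1\}$ satisfies $\omega^{n-1}=1$; (vi) $p(\mathbf{x})=-b+a\prod_{i=1}^n(x_i+b)$, where $a\in R\setminus\{0\}$ and $b\in\mathrm{Frac}(R)$ satisfy $ab^n-b\in R$ and $ab^k\in R$ for every $k\in\{1,\ldots,n-1\}$. Then the $n$-ary semigroup $(R,p)$ is medial.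
   Context: Here $\mathbf{x}=(x_1,\ldots,x_n)$ and $\mathrm{Frac}(R)$ is the fraction field of $R$. An $n$-ary structure $(G,f)$ with $f\colon G^n\to G$ is medial if for every $n\times n$ array $(x_{ij})$ of elements of $G$, $$f\big(f(x_{11},\ldots,x_{1n}),\ldots,f(x_{n1},\ldots,x_{nn})\big)=f\big(f(x_{11},\ldots,x_{n1}),\ldots,f(x_{1n},\ldots,x_{nn})\big).$$ The pair $(R,p)$ is an $n$-ary semigroup if $p$ is associative, i.e. for every $i\in\{1,\ldots,n-1\}$ and all $x_1,\ldots,x_{2n-1}\in R$, $p(x_1,\ldots,x_{i-1},p(x_i,\ldots,x_{i+n-1}),x_{i+n},\ldots,x_{2n-1})=p(x_1,\ldots,x_i,p(x_{i+1},\ldots,x_{i+n}),x_{i+n+1},\ldots,x_{2n-1})$; all the functions listed are associative. *)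

(* Defs.v *)
From mathcomp Require Import all_boot all_order all_algebra fraction.
From mathcomp Require Import classical_sets cardinality.

Set Implicit Arguments.
Unset Strict Implicit.
Unset Printing Implicit Defensive.

Import GRing.Theory.
Local Open Scope ring_scope.

(* Components are numbered from 0: the x_i of the usual 1-based notation is
   x (i - 1) here. *)
Definition nary_op (n : nat) (T : Type) : Type := {ffun 'I_n -> T} -> T.

Definition medial (n : nat) (T : Type) (f : nary_op n T) : Prop :=
  forall x : 'I_n -> 'I_n -> T,
    f [ffun i => f [ffun j => x i j]] = f [ffun j => f [ffun i => x i j]].

(* f (x_0, ..., x_(i-1), f (x_i, ..., x_(i+n-1)), x_(i+n), ..., x_(2n-2)).
   The 2n-1 variables are presented as a sequence x : nat -> T, of which, for
   i < n, only the terms x 0, ..., x (2n-2) occur. *)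
Definition nested (n : nat) (T : Type) (f : nary_op n T) (x : nat -> T)
    (i : nat) : T :=
  f [ffun j : 'I_n =>
       if (j < i)%N then x j
       else if (j == i :> nat)%N then f [ffun k : 'I_n => x (i + k)%N]
       else x (j + n.-1)%N].

Definition nary_semigroup (n : nat) (T : Type) (f : nary_op n T) : Prop :=
  forall (i : nat) (x : nat -> T),
    (i.+1 < n)%N -> nested f x i = nested f x i.+1.

Definition in_base (R : idomainType) (y : {fraction R}) : Prop :=
  exists r : R, y = FracField.tofrac r.

(* Main.v *)
(** Every operation in the list other than a constant or a projection is, up to
    an injective change of variable, a twisted iterated operation
    [c + \sum_i w ^+ i * x_i] or [a * \prod_i x_i].  Nesting such an operation
    at any place gives the same iterated operation over all 2n-1 variables,
    whence associativity, and mediality is the exchange of two iterated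
    operations. For (vi) the change of variable is [x |-> x + b], from [R] into
    its fraction field. *)

Require Import Defs.
From mathcomp Require Import all_boot all_order all_algebra fraction.
From mathcomp Require Import classical_sets cardinality.

Set Implicit Arguments.
Unset Strict Implicit.
Unset Printing Implicit Defensive.

Import GRing.Theory.
Local Open Scope ring_scope.

(** The inner block at place [i] covers the indices from [i] to [i + n - 1], and the entries before
    and after it cover the rest; commutativity then brings [a] to the front. The right-hand side
    does not involve [i], which is what associativity asks for. *)
Lemma big_nested_window (T : Type) (idx : T) (op : Monoid.com_law idx)
    (n i : nat) (a : T) (F : nat -> T) :
  (i < n)%N ->
  \big[op/idx]_(j < n)
    (if (j < i)%N then F j
     else if (j == i :> nat)%N then op a (\big[op/idx]_(k < n) F (i + k)%N)
     else F (j + n.-1)%N)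
  = op a (\big[op/idx]_(m < n + n.-1) F m).
Proof.
move=> lt_in; set G := fun j : nat => if (j < i)%N then F j
  else if (j == i)%N then op a (\big[op/idx]_(k < n) F (i + k)%N)
  else F (j + n.-1)%N.
rewrite -[LHS](big_mkord xpredT G) -(big_mkord xpredT F).
rewrite (@big_cat_nat _ _ _ i) ?(ltnW lt_in) //= (big_ltn lt_in).
rewrite (@big_cat_nat _ _ _ i 0 (n + n.-1)%N) //=; last first.
  by rewrite (leq_trans (ltnW lt_in)) ?leq_addr.
rewrite (@big_cat_nat _ _ _ (i + n)%N i (n + n.-1)%N) ?leq_addr //=; last first.
  by rewrite addnC leq_add2l -ltnS (ltn_predK lt_in).
have -> : \big[op/idx]_(0 <= j < i) G j = \big[op/idx]_(0 <= j < i) F j.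
  by apply: eq_big_nat => j /andP[_ lt_ji]; rewrite /G lt_ji.
have -> : G i = op a (\big[op/idx]_(i <= m < i + n) F m).
  rewrite /G ltnn eqxx; congr (op a _).
  rewrite -(big_mkord xpredT (fun k => F (i + k)%N)).
  rewrite -{1}[i in RHS]add0n big_addn addKn.
  by apply: eq_bigr => k _; rewrite addnC.
have -> : \big[op/idx]_(i.+1 <= j < n) G j
    = \big[op/idx]_(i + n <= m < n + n.-1) F m.
  (* Shifting by [n.-1] carries the places after [i] onto the indices from [i + n] on. *)
  have -> : (i + n = i.+1 + n.-1)%N by rewrite addSnnS (ltn_predK lt_in).
  rewrite big_addn addnK; apply: eq_big_nat => j /andP[lt_ij _].
  by rewrite /G ltnNge (ltnW lt_ij) /= gtn_eqF.
by rewrite -!Monoid.mulmA Monoid.mulmCA.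
Qed.

Lemma projection_first_semigroup (n : nat) (T : Type) (p : nary_op n T)
    (k : 'I_n) :
  k = 0%N :> nat -> (forall x, p x = x k) -> nary_semigroup p.
Proof.
move=> k0 pE i x _; rewrite /nested !pE !ffunE k0.
by case: i => [|i] //=; rewrite pE ffunE k0.
Qed.

Lemma projection_last_semigroup (n : nat) (T : Type) (p : nary_op n T)
    (k : 'I_n) :
  k = n.-1 :> nat -> (forall x, p x = x k) -> nary_semigroup p.
Proof.
move=> kn pE i x lt_in; rewrite /nested !pE !ffunE kn.
have lt_ik : (i < n.-1)%N by rewrite -ltnS (ltn_predK lt_in).
rewrite ltnNge (ltnW lt_ik) /= gtn_eqF // ltnNge lt_ik /=.
(* If [i.+1] is the last place, the inner operation sits there, and its own last entry is again the
   term of index [2n - 2]. *)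
by case: eqP => // <-.
Qed.

Lemma projection_medial (n : nat) (T : Type) (p : nary_op n T) (k : 'I_n) :
  (forall x, p x = x k) -> medial p.
Proof. by move=> pE x; rewrite !pE !ffunE !pE !ffunE. Qed.

(** The condition on [c] lets the inner constant come out unchanged from any place, and
    [w ^+ n.-1 = 1] makes the weight of an entry after the inner operation agree with that of its
    index, which is larger by [n.-1]. *)
Lemma affine_semigroup (R : comNzRingType) (n : nat) (p : nary_op n R)
    (c w : R) :
  (forall i, w ^+ i * c = c) -> w ^+ n.-1 = 1 ->
  (forall x, p x = c + \sum_(i < n) w ^+ i * x i) ->
  nary_semigroup p.
Proof.
move=> wc wn pE i x lt_in.
have nestedE k : (k < n)%N ->
    nested p x k = c + (c + \sum_(m < n + n.-1) w ^+ m * x m).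
  move=> lt_kn; rewrite /nested pE.
  rewrite -(big_nested_window _ _ (fun m => w ^+ m * x m) lt_kn).
  congr (c + _); apply: eq_bigr => j _; rewrite ffunE.
  case: ltnP => // _; case: eqP => [->|_].
    rewrite pE mulrDr wc mulr_sumr; congr (c + _).
    by apply: eq_bigr => m _; rewrite ffunE mulrA exprD.
  by rewrite exprD wn mulr1.
by rewrite !nestedE // ltnW.
Qed.

Lemma affine_medial (R : comNzRingType) (n : nat) (p : nary_op n R) (c w : R) :
  (forall x, p x = c + \sum_(i < n) w ^+ i * x i) -> medial p.
Proof.
move=> pE x; rewrite !pE; congr (c + _).
under eq_bigr do rewrite ffunE pE mulrDr mulr_sumr.
under [RHS]eq_bigr do rewrite ffunE pE mulrDr mulr_sumr.
(* The constants contribute equally to both sides, and the weights [w ^+ i * w ^+ j] are symmetric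
   in [i] and [j]. *)
rewrite !big_split /= exchange_big; congr (_ + _).
apply: eq_bigr => i _; apply: eq_bigr => j _.
by rewrite !ffunE mulrCA.
Qed.

Section ConjugateProduct.

Variables (T : Type) (K : comNzRingType) (n : nat) (p : nary_op n T).
Variables (g : T -> K) (a : K).
Hypothesis g_inj : injective g.
Hypothesis gpE : forall x, g (p x) = a * \prod_(i < n) g (x i).

Lemma conjugate_product_semigroup : nary_semigroup p.
Proof.
move=> i x lt_in; apply: g_inj.
have nestedE k : (k < n)%N ->
    g (nested p x k) = a * (a * \prod_(m < n + n.-1) g (x m)).
  move=> lt_kn; rewrite /nested gpE.
  rewrite -(big_nested_window _ _ (fun m => g (x m)) lt_kn).
  congr (a * _); apply: eq_bigr => j _; rewrite ffunE.
  case: ltnP => // _; case: eqP => // _.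
  by rewrite gpE; congr (a * _); apply: eq_bigr => m _; rewrite ffunE.
by rewrite !nestedE // ltnW.
Qed.

Lemma conjugate_product_medial : medial p.
Proof.
move=> x; apply: g_inj; rewrite !gpE; congr (a * _).
under eq_bigr do rewrite ffunE gpE.
under [RHS]eq_bigr do rewrite ffunE gpE.
(* Both sides carry the same power of [a]; only the order of the double product differs. *)
rewrite !big_split /= exchange_big; congr (_ * _).
by apply: eq_bigr => i _; apply: eq_bigr => j _; rewrite !ffunE.
Qed.

End ConjugateProduct.

Theorem mainTheorem3 (R : idomainType) (R_infinite : infinite_set [set: R]%classic)
    (n : nat) (n_ge2 : (2 <= n)%N) (p : nary_op n R) :
  (* (i) *)
  (exists c : R, forall x, p x = c) \/
  (* (ii) *)
  (exists2 k : 'I_n, k = 0%N :> nat & forall x, p x = x k) \/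
  (* (iii) *)
  (exists2 k : 'I_n, k = n.-1 :> nat & forall x, p x = x k) \/
  (* (iv) *)
  (exists c : R, forall x, p x = c + \sum_(i < n) x i) \/
  (* (v) *)
  ((3 <= n)%N /\
   exists w : R, [/\ w <> 1, w ^+ n.-1 = 1
     & forall x, p x = \sum_(i < n) w ^+ i * x i]) \/
  (* (vi) *)
  (exists (a : R) (b : {fraction R}),
     [/\ a <> 0,
         in_base (FracField.tofrac a * b ^+ n - b),
         forall k : nat, (1 <= k <= n.-1)%N -> in_base (FracField.tofrac a * b ^+ k)
       & forall x, FracField.tofrac (p x) =
           - b + FracField.tofrac a * \prod_(i < n) (FracField.tofrac (x i) + b)]) ->
  nary_semigroup p /\ medial p.
Proof.
case=> [[c pE]|[[k k0 pE]|[[k kn pE]|[[c pE]|[[_ [w [_ wn pE]]]|]]]]].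
- by split=> [i x _|x]; rewrite /nested !pE.
- by split; [apply: projection_first_semigroup pE | apply: projection_medial pE].
- by split; [apply: projection_last_semigroup pE | apply: projection_medial pE].
(* The untwisted sum is the affine case [w = 1]. *)
- have pE1 x : p x = c + \sum_(i < n) 1 ^+ i * x i.
    by rewrite pE; under [in RHS]eq_bigr do rewrite expr1n mul1r.
  split; last exact: affine_medial pE1.
  by apply: affine_semigroup pE1 => [i|]; rewrite expr1n ?mul1r.
- have pE0 x : p x = 0 + \sum_(i < n) w ^+ i * x i by rewrite add0r.
  split; last exact: affine_medial pE0.
  by apply: affine_semigroup pE0 => // i; rewrite mulr0.
- case=> a [b [_ _ _ pE]].
  (* Adding [b] cancels the outer [- b] and leaves a pure product. *)
  pose g (r : R) := FracField.tofrac r + b.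
  have g_inj : injective g by move=> r s /addIr/eqP; rewrite tofrac_eq => /eqP.
  have gpE x : g (p x) = FracField.tofrac a * \prod_(i < n) g (x i).
    by rewrite /g pE addrC addNKr.
  split; first exact: conjugate_product_semigroup g_inj gpE.
  exact: conjugate_product_medial g_inj gpE.
Qed.
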